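(* Let $G$ be a finite group scheme over a field $k$ of characteristic $p>0$. Let $M$ and $N$ be $kG$-modules of constant Jordan type, and suppose that $$0\to M\to B\to N\to 0$$ is an exact sequence of $kG$-modules. Let $\zeta\in\mathrm{Ext}^1_{kG}(N,M)$ be the class of this sequence. If for every $\pi$-point $\alpha_K:K[t]/t^p\to KG$ the restriction of $\zeta$ along $\alpha_K$ is zero, i.e. $\alpha_K^*(\zeta_K)=0$ in $\mathrm{Ext}^1_{K[t]/t^p}(\alpha_K^*(N_K),\alpha_K^*(M_K))$, then $B$ has constant Jordan type. Moreover, if the Jordan types of $M$ and $N$ are $\sum_{i=1}^p m_i[i]$ and $\sum_{i=1}^p n_i[i]$, then the Jordan type of $B$ is $\sum_{i=1}^p(m_i+n_i)[i]$.
   Context: $k$ is a field of characteristic $p>0$. A finite group scheme $G$ over $k$ is a group scheme whose coordinate algebra $k[G]$ is finite dimensional; its group algebra $kG$ is the linear dual of $k[G]$. All $kG$-modules are finitely generated. For a field extension $K/k$, $KG=K\otimes_k kG$ is the group algebra of $G_K=G\times_{\mathrm{Spec}\,k}\mathrm{Spec}\,K$, $M_K=K\otimes_k M$, and $\zeta_K$ is the base change of $\zeta$. A $\pi$-point of $G$ is a left flat map of $K$-algebras $\alpha_K:K[t]/t^p\to KG$, for some field extension $K/k$, which factors through the group algebra $KC_K\subset KG$ of some unipotent abelian subgroup scheme $C_K\subset G_K$; $\alpha_K^*$ denotes restriction along $\alpha_K$. Every finite dimensional $K[t]/t^p$-module is a direct sum of $a_i$ copies of the indecomposables $[i]=K[t]/t^i$,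 $1\le i\le p$; its Jordan type is written $a_p[p]+\cdots+a_1[1]$. A finite dimensional $kG$-module $M$ has constant Jordan type if the Jordan type of $\alpha_K^*(M_K)$ is the same for all $\pi$-points $\alpha_K$ of $G$; this common type is the Jordan type of $M$. *)

(* Defs.v *)
From HB Require Import structures.
From mathcomp Require Import all_boot all_order all_algebra.
From mathcomp Require Import qpoly.
From mathcomp Require Import boolp.

Set Implicit Arguments.
Unset Strict Implicit.
Unset Printing Implicit Defensive.

Import GRing.Theory.
Local Open Scope ring_scope.

(* A finite group scheme G over k is given by its coordinate algebra k[G]:
   a finite dimensional commutative Hopf algebra, written in a chosen k-basis
   (e_i) by its structure constants
     e_i e_j = \sum_l gs_mul i j l e_l        1 = \sum_l gs_unit l e_l
     Delta e_l = \sum_(i,j) gs_comul l i j e_i (x) e_j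
     eps e_i = gs_counit i                    S e_i = \sum_j gs_antip i j e_j *)
Record finGroupScheme (k : fieldType) := FinGroupScheme {
  gs_dim : nat;
  gs_mul : 'I_gs_dim -> 'I_gs_dim -> 'I_gs_dim -> k;
  gs_unit : 'I_gs_dim -> k;
  gs_comul : 'I_gs_dim -> 'I_gs_dim -> 'I_gs_dim -> k;
  gs_counit : 'I_gs_dim -> k;
  gs_antip : 'I_gs_dim -> 'I_gs_dim -> k;
  gs_mulA : forall a b c d,
    \sum_r gs_mul a b r * gs_mul r c d = \sum_r gs_mul b c r * gs_mul a r d;
  gs_mulC : forall a b c, gs_mul a b c = gs_mul b a c;
  gs_mul1 : forall a b, \sum_r gs_unit r * gs_mul r a b = (a == b)%:R;
  gs_comulA : forall a b c d,
    \sum_r gs_comul a r d * gs_comul r b c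
      = \sum_r gs_comul a b r * gs_comul r c d;
  gs_comul1l : forall a b, \sum_r gs_counit r * gs_comul a r b = (a == b)%:R;
  gs_comul1r : forall a b, \sum_r gs_comul a b r * gs_counit r = (a == b)%:R;
  gs_comulM : forall a b c d,
    \sum_r gs_mul a b r * gs_comul r c d
      = \sum_a1 \sum_a2 \sum_b1 \sum_b2
          gs_comul a a1 a2 * gs_comul b b1 b2
            * gs_mul a1 b1 c * gs_mul a2 b2 d;
  gs_comulU : forall c d,
    \sum_r gs_unit r * gs_comul r c d = gs_unit c * gs_unit d;
  gs_counitM : forall a b,
    \sum_r gs_mul a b r * gs_counit r = gs_counit a * gs_counit b;
  gs_counitU : \sum_r gs_unit r * gs_counit r = 1;
  gs_antipl : forall a d,
    \sum_b \sum_c \sum_r gs_comul a b c * gs_antip b r * gs_mul r c d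
      = gs_counit a * gs_unit d;
  gs_antipr : forall a d,
    \sum_b \sum_c \sum_r gs_comul a b c * gs_antip c r * gs_mul b r d
      = gs_counit a * gs_unit d
}.

Section BaseChangeScheme.
Variables (k K : fieldType) (f : {rmorphism k -> K}) (G : finGroupScheme k).

Let E1 (I : finType) (F : I -> k) (F' : I -> K) :
  (forall i, F' i = f (F i)) -> \sum_i F' i = f (\sum_i F i).
Proof. by move=> h; rewrite rmorph_sum; apply: eq_bigr => i _. Qed.

(* G_K : the coordinate algebra K (x) k[G] in the basis 1 (x) e_i. *)
Program Definition base_scheme : finGroupScheme K :=
  @FinGroupScheme K (gs_dim G)
    (fun a b c => f (gs_mul a b c)) (fun a => f (gs_unit a))
    (fun a b c => f (gs_comul a b c)) (fun a => f (gs_counit a))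
    (fun a b => f (gs_antip a b)) _ _ _ _ _ _ _ _ _ _ _ _.
Next Obligation.
rewrite (E1 (fun r => esym (rmorphM f _ _))) gs_mulA.
by rewrite rmorph_sum; apply: eq_bigr => r _; rewrite rmorphM.
Qed.
Next Obligation. by rewrite gs_mulC. Qed.
Next Obligation.
by rewrite (E1 (fun r => esym (rmorphM f _ _))) gs_mul1 rmorph_nat.
Qed.
Next Obligation.
rewrite (E1 (fun r => esym (rmorphM f _ _))) gs_comulA.
by rewrite rmorph_sum; apply: eq_bigr => r _; rewrite rmorphM.
Qed.
Next Obligation.
by rewrite (E1 (fun r => esym (rmorphM f _ _))) gs_comul1l rmorph_nat.
Qed.
Next Obligation.
by rewrite (E1 (fun r => esym (rmorphM f _ _))) gs_comul1r rmorph_nat.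
Qed.
Next Obligation.
rewrite (E1 (fun r => esym (rmorphM f _ _))) gs_comulM.
rewrite rmorph_sum; apply: eq_bigr => a1 _.
rewrite rmorph_sum; apply: eq_bigr => a2 _.
rewrite rmorph_sum; apply: eq_bigr => b1 _.
by rewrite rmorph_sum; apply: eq_bigr => b2 _; rewrite !rmorphM.
Qed.
Next Obligation.
by rewrite (E1 (fun r => esym (rmorphM f _ _))) gs_comulU rmorphM.
Qed.
Next Obligation.
by rewrite (E1 (fun r => esym (rmorphM f _ _))) gs_counitM rmorphM.
Qed.
Next Obligation.
by rewrite (E1 (fun r => esym (rmorphM f _ _))) gs_counitU rmorph1.
Qed.
Next Obligation.
rewrite -rmorphM -gs_antipl rmorph_sum; apply: eq_bigr => b _.
rewrite rmorph_sum; apply: eq_bigr => c _.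
by rewrite rmorph_sum; apply: eq_bigr => r _; rewrite !rmorphM.
Qed.
Next Obligation.
rewrite -rmorphM -gs_antipr rmorph_sum; apply: eq_bigr => b _.
rewrite rmorph_sum; apply: eq_bigr => c _.
by rewrite rmorph_sum; apply: eq_bigr => r _; rewrite !rmorphM.
Qed.
End BaseChangeScheme.

(* kG, the linear dual of k[G], in the basis dual to (e_i): the functional x
   is the row vector of its values x(e_i); the product is dual to Delta and the
   unit is the counit of k[G]. *)
Definition groupAlg_type (k : fieldType) (G : finGroupScheme k) :=
  'rV[k]_(gs_dim G).

Section GroupAlgebra.
Variables (k : fieldType) (G : finGroupScheme k).
Local Notation kG := (groupAlg_type G).
Implicit Types x y z : kG.

HB.instance Definition _ := Vector.on kG.

Definition ga_one : kG := \row_a gs_counit a.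
Definition ga_mul x y : kG :=
  \row_a \sum_b \sum_c gs_comul a b c * (x 0 b * y 0 c).

Lemma ga_mulA : associative ga_mul.
Proof.
move=> x y z; apply/rowP => a; rewrite !mxE.
transitivity (\sum_b \sum_c \sum_d
    (\sum_r gs_comul a b r * gs_comul r c d) * (x 0 b * y 0 c * z 0 d)).
  apply: eq_bigr => b _.
  transitivity (\sum_r \sum_c \sum_d
     gs_comul a b r * gs_comul r c d * (x 0 b * y 0 c * z 0 d)).
    apply: eq_bigr => r _; rewrite mxE !mulr_sumr; apply: eq_bigr => c _.
    rewrite !mulr_sumr; apply: eq_bigr => d _.
    rewrite !mulrA; congr (_ * _ * _); rewrite -!mulrA.
    by congr (_ * _); rewrite mulrC.
  rewrite exchange_big; apply: eq_bigr => c _.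
  rewrite exchange_big; apply: eq_bigr => d _.
  by rewrite mulr_suml.
transitivity (\sum_b \sum_c \sum_d
    (\sum_r gs_comul a r d * gs_comul r b c) * (x 0 b * y 0 c * z 0 d)).
  apply: eq_bigr => b _; apply: eq_bigr => c _; apply: eq_bigr => d _.
  by rewrite gs_comulA.
transitivity (\sum_r \sum_d \sum_b \sum_c
     gs_comul a r d * gs_comul r b c * (x 0 b * y 0 c * z 0 d)); last first.
  apply: eq_bigr => r _; apply: eq_bigr => d _.
  rewrite mxE mulr_suml mulr_sumr; apply: eq_bigr => b _.
  rewrite mulr_suml mulr_sumr; apply: eq_bigr => c _.
  by rewrite !mulrA.
transitivity (\sum_b \sum_c \sum_d \sum_r
     gs_comul a r d * gs_comul r b c * (x 0 b * y 0 c * z 0 d)).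
  apply: eq_bigr => b _; apply: eq_bigr => c _; apply: eq_bigr => d _.
  by rewrite mulr_suml.
rewrite [RHS]exchange_big /=.
transitivity (\sum_b \sum_d \sum_c \sum_r
     gs_comul a r d * gs_comul r b c * (x 0 b * y 0 c * z 0 d)).
  by apply: eq_bigr => b _; rewrite exchange_big.
rewrite exchange_big; apply: eq_bigr => d _ /=.
rewrite [RHS]exchange_big; apply: eq_bigr => b _ /=.
by rewrite exchange_big.
Qed.

Lemma ga_mul1l : left_id ga_one ga_mul.
Proof.
move=> x; apply/rowP => a; rewrite mxE exchange_big /=.
rewrite (bigD1 a) //= [X in _ + X]big1 ?addr0 => [|c /negPf nca].
  rewrite -[RHS]mul1r -(_ : \sum_r gs_counit r * gs_comul a r a = 1).
    rewrite mulr_suml; apply: eq_bigr => b _.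
  by rewrite mxE mulrA [in LHS](mulrC (gs_comul _ _ _)).
  by rewrite gs_comul1l eqxx.
transitivity ((\sum_r gs_counit r * gs_comul a r c) * x 0 c).
  rewrite mulr_suml; apply: eq_bigr => b _.
  by rewrite mxE mulrA [in LHS](mulrC (gs_comul _ _ _)).
by rewrite gs_comul1l eq_sym nca mul0r.
Qed.

Lemma ga_mul1r : right_id ga_one ga_mul.
Proof.
move=> x; apply/rowP => a; rewrite mxE.
have E b : \sum_c gs_comul a b c * (x 0 b * ga_one 0 c) = (a == b)%:R * x 0 b.
  rewrite -gs_comul1r mulr_suml; apply: eq_bigr => c _.
  by rewrite mxE mulrA mulrAC.
rewrite (eq_bigr _ (fun b _ => E b)) (bigD1 a) //= eqxx mul1r big1 ?addr0 // => b.
by rewrite eq_sym => /negPf ->; rewrite mul0r.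
Qed.

Lemma ga_mulDl : left_distributive ga_mul +%R.
Proof.
move=> x y z; apply/rowP => a; rewrite !mxE -big_split; apply: eq_bigr => b _ /=.
by rewrite -big_split; apply: eq_bigr => c _ /=; rewrite mxE mulrDl mulrDr.
Qed.

Lemma ga_mulDr : right_distributive ga_mul +%R.
Proof.
move=> x y z; apply/rowP => a; rewrite !mxE -big_split; apply: eq_bigr => b _ /=.
by rewrite -big_split; apply: eq_bigr => c _ /=; rewrite mxE !mulrDr.
Qed.

Lemma ga_one_neq0 : ga_one != 0.
Proof.
apply/eqP => /rowP h; have /eqP := gs_counitU G.
rewrite big1 => [|r _]; first by rewrite eq_sym oner_eq0.
by have := h r; rewrite !mxE => ->; rewrite mulr0.
Qed.

HB.instance Definition _ := GRing.Zmodule_isNzRing.Build kG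
  ga_mulA ga_mul1l ga_mul1r ga_mulDl ga_mulDr ga_one_neq0.

Lemma ga_scaleAl (a : k) (x y : kG) : a *: (x * y) = (a *: x) * y.
Proof.
apply/rowP => r; rewrite !mxE mulr_sumr; apply: eq_bigr => b _.
by rewrite mulr_sumr; apply: eq_bigr => c _; rewrite mxE mulrCA !mulrA.
Qed.

HB.instance Definition _ := GRing.Lmodule_isLalgebra.Build k kG ga_scaleAl.

Lemma ga_scaleAr (a : k) (x y : kG) : a *: (x * y) = x * (a *: y).
Proof.
apply/rowP => r; rewrite !mxE mulr_sumr; apply: eq_bigr => b _.
rewrite mulr_sumr; apply: eq_bigr => c _; rewrite mxE mulrCA; congr (_ * _).
by rewrite mulrCA.
Qed.

HB.instance Definition _ := GRing.Lalgebra_isAlgebra.Build k kG ga_scaleAr.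

(* The counit of kG: evaluation at 1 in k[G]. *)
Definition ga_aug (x : kG) : k := \sum_a gs_unit a * x 0 a.

Definition ga_basis (a : 'I_(gs_dim G)) : kG := delta_mx 0 a.

Lemma ga_basisE (x : kG) : x = \sum_a x 0 a *: ga_basis a.
Proof. exact: row_sum_delta. Qed.

Lemma ga_basisM a b :
  ga_basis a * ga_basis b = \sum_c gs_comul c a b *: ga_basis c.
Proof.
rewrite [LHS]ga_basisE; apply: eq_bigr => c _; congr (_ *: _); rewrite mxE.
rewrite (bigD1 a) //= [X in _ + X]big1 ?addr0 => [|i /negPf ni]; last first.
  by apply: big1 => j _; rewrite !mxE ni andbF mul0r mulr0.
rewrite (bigD1 b) //= big1 ?addr0 => [|j /negPf nj]; last first.
  by rewrite !mxE nj andbF !mulr0.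
by rewrite !mxE !eqxx !mulr1.
Qed.

End GroupAlgebra.

Definition groupAlg (k : fieldType) (G : finGroupScheme k) : algType k :=
  GRing.Algebra.clone k (groupAlg_type G) _.

Section Modules.
Variables (F : fieldType) (A : algType F).

(* A finite dimensional left A-module F^n, with a in A acting on column
   vectors by v |-> mact a *m v. *)
Record fdModule := FdModule {
  mdim : nat;
  mact : {lrmorphism A -> 'M[F]_mdim}
}.

Record modHom (M N : fdModule) := ModHom {
  hom_mx :> 'M[F]_(mdim N, mdim M);
  hom_mxP : forall a, mact N a *m hom_mx = hom_mx *m mact M a
}.

Definition mod_iso (M N : fdModule) : Prop :=
  exists (f : modHom M N) (g : modHom N M), g *m f = 1%:M /\ f *m g = 1%:M.

Definition zero_act (a : A) : 'M[F]_0 := 0.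
Lemma zero_act_linear : linear zero_act.
Proof. by move=> c a b; rewrite /zero_act scaler0 addr0. Qed.
Lemma zero_act_mult : monoid_morphism zero_act.
Proof. by split=> [|a b]; apply/matrixP => -[]. Qed.
HB.instance Definition _ :=
  GRing.isLinear.Build F A 'M[F]_0 _ zero_act zero_act_linear.
HB.instance Definition _ :=
  GRing.isMonoidMorphism.Build A 'M[F]_0 zero_act zero_act_mult.
Definition zero_mod : fdModule := FdModule zero_act.

Section DirectSum.
Variables M N : fdModule.
Definition dsum_act (a : A) : 'M[F]_(mdim M + mdim N) :=
  block_mx (mact M a) 0 0 (mact N a).
Lemma dsum_act_linear : linear dsum_act.
Proof.
move=> c a b.
by rewrite /dsum_act !linearP scale_block_mx add_block_mx !scaler0 !addr0.
Qed.
Lemma dsum_act_mult : monoid_morphism dsum_act.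
Proof.
split=> [|a b]; rewrite /dsum_act; first by rewrite !rmorph1 -scalar_mx_block.
by rewrite !rmorphM /= -!mulmxE mulmx_block !(mulmx0, mul0mx, addr0, add0r).
Qed.
HB.instance Definition _ :=
  GRing.isLinear.Build F A 'M[F]_(mdim M + mdim N) _ dsum_act dsum_act_linear.
HB.instance Definition _ :=
  GRing.isMonoidMorphism.Build A 'M[F]_(mdim M + mdim N) dsum_act dsum_act_mult.
Definition dsum : fdModule := FdModule dsum_act.
End DirectSum.

Definition short_exact (M B N : fdModule) (i : modHom M B) (q : modHom B N)
    : Prop :=
  [/\ injective (fun v : 'cV[F]_(mdim M) => i *m v),
      (forall w : 'cV[F]_(mdim N), exists v : 'cV[F]_(mdim B), q *m v = w)
    & (forall v : 'cV[F]_(mdim B),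
        q *m v = 0 <-> exists u : 'cV[F]_(mdim M), v = i *m u)].

Record extension (N M : fdModule) := Extension {
  ext_mod : fdModule;
  ext_inj : modHom M ext_mod;
  ext_proj : modHom ext_mod N;
  ext_exact : short_exact ext_inj ext_proj
}.

Definition ext_equiv (N M : fdModule) (E E' : extension N M) : Prop :=
  exists (f : modHom (ext_mod E) (ext_mod E'))
         (g : modHom (ext_mod E') (ext_mod E)),
    [/\ g *m f = 1%:M, f *m g = 1%:M,
        f *m ext_inj E = ext_inj E' & ext_proj E' *m f = ext_proj E].

Section Equiv.
Variables N M : fdModule.
Implicit Types E : extension N M.

Lemma modHom1P (B : fdModule) a : mact B a *m 1%:M = 1%:M *m mact B a.
Proof. by rewrite mulmx1 mul1mx. Qed.
Definition modHom1 B : modHom B B := ModHom (@modHom1P B).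

Lemma modHom_compP (B C D : fdModule) (g : modHom C D) (f : modHom B C) a :
  mact D a *m (g *m f) = (g *m f) *m mact B a.
Proof. by rewrite mulmxA hom_mxP -mulmxA hom_mxP mulmxA. Qed.
Definition modHom_comp (B C D : fdModule) (g : modHom C D) (f : modHom B C) :
  modHom B D := ModHom (modHom_compP g f).

Lemma ext_equiv_refl E : ext_equiv E E.
Proof. by exists (modHom1 _), (modHom1 _); split; rewrite /= ?mulmx1 ?mul1mx. Qed.

Lemma ext_equiv_sym E E' : ext_equiv E E' -> ext_equiv E' E.
Proof.
case=> f [g [gf fg fi qf]]; exists g, f; split=> //.
  by rewrite -fi mulmxA gf mul1mx.
by rewrite -qf -mulmxA fg mulmx1.
Qed.

Lemma ext_equiv_trans E E' E'' :
  ext_equiv E E' -> ext_equiv E' E'' -> ext_equiv E E''.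
Proof.
case=> f [g [gf fg fi qf]] [f' [g' [gf' fg' fi' qf']]].
exists (modHom_comp f' f), (modHom_comp g g'); split=> /=.
- by rewrite mulmxA -(mulmxA g) gf' mulmx1.
- by rewrite mulmxA -(mulmxA f') fg mulmx1.
- by rewrite -mulmxA fi.
- by rewrite mulmxA qf'.
Qed.

(* Ext^1_A(N, M) as the set of Yoneda equivalence classes of extensions. *)
Definition Ext1 := {c : extension N M -> Prop | exists E, c = ext_equiv E}.

Definition ext_class E : Ext1 := exist _ (ext_equiv E) (ex_intro _ E erefl).

Lemma ext_classP E E' : ext_class E = ext_class E' <-> ext_equiv E E'.
Proof.
split=> [[EE']|EE'].
  by apply: ext_equiv_sym; rewrite -EE'; apply: ext_equiv_refl.
apply: eq_exist; apply/funext => E0; apply/propext; split=> h.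
  exact: ext_equiv_trans (ext_equiv_sym EE') h.
exact: ext_equiv_trans EE' h.
Qed.
End Equiv.
End Modules.

Section SplitExtension.
Variables (F : fieldType) (A : algType F) (N M : fdModule A).

Definition dsum_inl_mx : 'M[F]_(mdim (dsum M N), mdim M) := col_mx 1%:M 0.
Definition dsum_outr_mx : 'M[F]_(mdim N, mdim (dsum M N)) := row_mx 0 1%:M.

Lemma dsum_inlP a :
  mact (dsum M N) a *m dsum_inl_mx = dsum_inl_mx *m mact M a.
Proof.
rewrite /= /dsum_act /dsum_inl_mx mul_block_col mul_col_mx.
by rewrite !(mulmx0, mul0mx, addr0, mulmx1, mul1mx).
Qed.
Definition dsum_inl : modHom M (dsum M N) := ModHom dsum_inlP.

Lemma dsum_outrP a :
  mact N a *m dsum_outr_mx = dsum_outr_mx *m mact (dsum M N) a.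
Proof.
rewrite /= /dsum_act /dsum_outr_mx mul_row_block mul_mx_row.
by rewrite !(mulmx0, mul0mx, addr0, add0r, mulmx1, mul1mx).
Qed.
Definition dsum_outr : modHom (dsum M N) N := ModHom dsum_outrP.

Lemma dsum_exact : short_exact dsum_inl dsum_outr.
Proof.
split=> [u v /= /(congr1 usubmx)|w|v] /=.
- by rewrite /dsum_inl_mx !mul_col_mx !col_mxKu !mul1mx.
- by exists (col_mx 0 w); rewrite mul_row_col mul0mx mul1mx add0r.
split=> [|[u ->]].
  rewrite -[v]vsubmxK mul_row_col mul0mx mul1mx add0r => ->.
  by exists (usubmx v); rewrite mul_col_mx mul1mx mul0mx.
by rewrite mul_col_mx mul_row_col !mul0mx mulmx0 addr0.
Qed.

Definition split_ext : extension N M := Extension dsum_exact.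

(* The zero of the Yoneda group Ext^1 is the class of M -> M (+) N -> N. *)
Definition Ext1_zero : Ext1 N M := ext_class split_ext.
End SplitExtension.

Section Ext1Map.
Variables (F F' : fieldType) (A : algType F) (A' : algType F').
Variables (N M : fdModule A) (N' M' : fdModule A').
Variable Phi : extension N M -> extension N' M'.
Hypothesis PhiP : forall E E', ext_equiv E E' -> ext_equiv (Phi E) (Phi E').

Definition Ext1_map_class (c : Ext1 N M) : extension N' M' -> Prop :=
  fun E' => exists2 E, sval c E & ext_equiv (Phi E) E'.

Lemma Ext1_map_classP c : exists E', Ext1_map_class c = ext_equiv E'.
Proof.
case: c => c [E cE]; exists (Phi E); apply/funext => E'; apply/propext.
rewrite /Ext1_map_class /= cE; split=> [[E0 EE0 h]|h].
  exact: ext_equiv_trans (PhiP EE0) h.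
by exists E => //; apply: ext_equiv_refl.
Qed.

Definition Ext1_map (c : Ext1 N M) : Ext1 N' M' :=
  exist _ (Ext1_map_class c) (Ext1_map_classP c).

Lemma Ext1_mapE E : Ext1_map (ext_class E) = ext_class (Phi E).
Proof.
apply: eq_exist; apply/funext => E'; apply/propext.
rewrite /Ext1_map_class /=; split=> [[E0 EE0 h]|h].
  exact: ext_equiv_trans (PhiP EE0) h.
by exists E => //; apply: ext_equiv_refl.
Qed.
End Ext1Map.

Section Restriction.
Variables (F : fieldType) (A B : algType F) (alpha : {lrmorphism A -> B}).

Definition res_mod (M : fdModule B) : fdModule A :=
  @FdModule F A (mdim M) (mact M \o alpha).

Definition res_hom (M N : fdModule B) (f : modHom M N) :
    modHom (res_mod M) (res_mod N) :=
  @ModHom F A (res_mod M) (res_mod N) f (fun a => hom_mxP f (alpha a)).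

Definition res_ext (N M : fdModule B) (E : extension N M) :
    extension (res_mod N) (res_mod M) :=
  @Extension F A (res_mod N) (res_mod M) (res_mod (ext_mod E))
    (res_hom (ext_inj E)) (res_hom (ext_proj E)) (ext_exact E).

Lemma res_ext_equiv (N M : fdModule B) (E E' : extension N M) :
  ext_equiv E E' -> ext_equiv (res_ext E) (res_ext E').
Proof. by case=> f [g [? ? ? ?]]; exists (res_hom f), (res_hom g). Qed.

Definition Ext1_res (N M : fdModule B) :
    Ext1 N M -> Ext1 (res_mod N) (res_mod M) :=
  Ext1_map (@res_ext_equiv N M).
End Restriction.

Lemma mx_cV_inj (F : fieldType) m n (X Y : 'M[F]_(m, n)) :
  (forall v : 'cV_n, X *m v = Y *m v) -> X = Y.
Proof. by move=> h; apply/trmx_inj/row_matrixP => j; rewrite -!tr_col !colE h. Qed.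

Lemma mx_cV_lift (F : fieldType) m n l (X : 'M[F]_(m, n)) (Y : 'M[F]_(m, l)) :
  (forall v : 'cV_l, exists u : 'cV_n, Y *m v = X *m u) ->
  exists Z, X *m Z = Y.
Proof.
move=> h; have [z zP] := choice (fun j : 'I_l => h (delta_mx j 0)).
exists (\matrix_(a, j) z j a 0); apply/matrixP => a j.
have /colP/(_ a) := zP j; rewrite -colE !mxE => ->.
by apply: eq_bigr => b _; rewrite mxE.
Qed.

Lemma short_exact_splitP (L : fieldType) (A : algType L) (M B N : fdModule A)
    (i : modHom M B) (q : modHom B N) :
  short_exact i q <->
  exists (r : 'M_(mdim M, mdim B)) (s : 'M_(mdim B, mdim N)),
    [/\ r *m i = 1%:M, q *m s = 1%:M, q *m i = 0 & i *m r + s *m q = 1%:M].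
Proof.
split=> [[inj_i surj_q ker_q]|[r [s [ri qs qi irsq]]]]; last first.
  split=> [u v /= e|w|v].
  - by rewrite -[u]mul1mx -ri -mulmxA e mulmxA ri mul1mx.
  - by exists (s *m w); rewrite mulmxA qs mul1mx.
  split=> [qv|[u ->]]; last by rewrite mulmxA qi mul0mx.
  exists (r *m v).
  by rewrite -[LHS]mul1mx -irsq mulmxDl -!mulmxA qv mulmx0 addr0.
have qi : q *m i = 0.
  by apply: mx_cV_inj => u; rewrite mul0mx -mulmxA; apply/ker_q; exists u.
have [s qs] : exists s, q *m s = 1%:M.
  by apply: mx_cV_lift => w; have [v] := surj_q w; exists v; rewrite mul1mx.
have [r ir] : exists r, i *m r = 1%:M - s *m q.
  apply: mx_cV_lift => v; have /ker_q [u ->] : q *m ((1%:M - s *m q) *m v) = 0.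
    by rewrite mulmxBl mul1mx mulmxBr !mulmxA qs mul1mx subrr.
  by exists u.
exists r, s; split=> //; last by rewrite ir subrK.
apply: mx_cV_inj => u; apply: inj_i => /=.
by rewrite mul1mx !mulmxA ir !mulmxBl mul1mx -(mulmxA s) qi mulmx0 mul0mx subr0.
Qed.

Section BaseChange.
Variables (k K : fieldType) (f : {rmorphism k -> K}) (G : finGroupScheme k).
Local Notation kG := (groupAlg G).
Local Notation KG := (groupAlg (base_scheme f G)).

(* M_K = K (x) M, on which x = \sum_a x_a ga_basis a in KG acts K-linearly. *)
Definition base_act (M : fdModule kG) (x : KG) : 'M[K]_(mdim M) :=
  \sum_(a < gs_dim G) x 0 a *: map_mx f (mact M (ga_basis a)).

Lemma base_act_linear M : linear (base_act M).
Proof.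
move=> c x y; rewrite /base_act scaler_sumr -big_split; apply: eq_bigr => a _ /=.
by rewrite !mxE scalerDl scalerA.
Qed.

Lemma base_act_mult M : monoid_morphism (base_act M).
Proof.
split=> [|x y].
  transitivity (map_mx f (mact M 1)); last by rewrite rmorph1 map_mx1.
  rewrite /base_act {1}[X in mact M X](ga_basisE (1 : kG)) !raddf_sum.
  apply: eq_bigr => a _.
  by rewrite /= linearZ /= map_mxZ !mxE.
have E a b : map_mx f (mact M (ga_basis a)) *m map_mx f (mact M (ga_basis b)) =
   \sum_c f (gs_comul c a b) *: map_mx f (mact M (ga_basis c)).
  rewrite -map_mxM mulmxE -rmorphM ga_basisM !raddf_sum.
  by apply: eq_bigr => c _; rewrite /= linearZ /= map_mxZ.
rewrite -mulmxE /base_act mulmx_suml.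
transitivity (\sum_(a < gs_dim G) \sum_(b < gs_dim G) \sum_(c < gs_dim G)
    (x 0 a * y 0 b * f (gs_comul c a b)) *:
     map_mx f (mact M (ga_basis c))); last first.
  apply: eq_bigr => a _; rewrite mulmx_sumr; apply: eq_bigr => b _.
  rewrite -scalemxAl -scalemxAr scalerA E scaler_sumr.
  by apply: eq_bigr => c _; rewrite scalerA.
transitivity (\sum_(c < gs_dim G) \sum_(a < gs_dim G) \sum_(b < gs_dim G)
    (x 0 a * y 0 b * f (gs_comul c a b)) *:
     map_mx f (mact M (ga_basis c))).
  apply: eq_bigr => c _; rewrite mxE scaler_suml; apply: eq_bigr => a _.
  by rewrite scaler_suml; apply: eq_bigr => b _; rewrite mulrC.
rewrite exchange_big; apply: eq_bigr => a _.
by rewrite exchange_big.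
Qed.

HB.instance Definition _ M :=
  GRing.isLinear.Build K KG 'M[K]_(mdim M) _ (base_act M) (base_act_linear M).
HB.instance Definition _ M :=
  GRing.isMonoidMorphism.Build KG 'M[K]_(mdim M) (base_act M) (base_act_mult M).

Definition base_mod (M : fdModule kG) : fdModule KG := FdModule (base_act M).

Section Hom.
Variables (M N : fdModule kG) (h : modHom M N).
Lemma base_homP (x : KG) :
  mact (base_mod N) x *m map_mx f h = map_mx f h *m mact (base_mod M) x.
Proof.
rewrite /= /base_act mulmx_suml mulmx_sumr; apply: eq_bigr => a _.
by rewrite -scalemxAl -scalemxAr -!map_mxM hom_mxP.
Qed.
Definition base_hom : modHom (base_mod M) (base_mod N) :=
  @ModHom K KG (base_mod M) (base_mod N) (map_mx f h) base_homP.
End Hom.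

Lemma base_exact (M B N : fdModule kG) (i : modHom M B) (q : modHom B N) :
  short_exact i q -> short_exact (base_hom i) (base_hom q).
Proof.
move=> /short_exact_splitP [r [s [ri qs qi irsq]]]; apply/short_exact_splitP.
exists (map_mx f r), (map_mx f s).
by split; rewrite -!map_mxM -?map_mxD ?ri ?qs ?qi ?irsq ?map_mx1 ?map_mx0.
Qed.

Definition base_ext (N M : fdModule kG) (E : extension N M) :
    extension (base_mod N) (base_mod M) :=
  Extension (base_exact (ext_exact E)).

Lemma base_ext_equiv (N M : fdModule kG) (E E' : extension N M) :
  ext_equiv E E' -> ext_equiv (base_ext E) (base_ext E').
Proof.
case=> g [h [hg gh gi qg]]; exists (base_hom g), (base_hom h).
by split; rewrite -map_mxM ?hg ?gh ?map_mx1 // ?gi ?qg.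
Qed.

Definition Ext1_base (N M : fdModule kG) :
    Ext1 N M -> Ext1 (base_mod N) (base_mod M) :=
  Ext1_map (@base_ext_equiv N M).

End BaseChange.

Section FlatMap.
Variables (R : comNzRingType) (A : nzRingType) (alpha : {rmorphism R -> A}).

(* \sum_(u, a) u (x) a = 0 in U (x)_R A, where A is a left R-module through
   alpha.  By the universal property of the tensor product, this holds iff every
   R-balanced biadditive map on U x A sends the family to 0. *)
Definition tensor_eq0 (U : lmodType R) (s : seq (U * A)) : Prop :=
  forall (W : zmodType) (b : U -> A -> W),
    (forall u v a, b (u + v) a = b u a + b v a) ->
    (forall u a a', b u (a + a') = b u a + b u a') ->
    (forall r u a, b (r *: u) a = b u (alpha r * a)) ->
  \sum_(x <- s) b x.1 x.2 = 0.

(* A is flat as a left R-module: - (x)_R A preserves injections. *)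
Definition left_flat : Prop :=
  forall (U V : lmodType R) (g : {linear U -> V}), injective g ->
  forall s : seq (U * A),
    tensor_eq0 [seq (g x.1, x.2) | x <- s] -> tensor_eq0 s.
End FlatMap.

(* K[t]/t^p (for p > 0). *)
Definition truncPoly (K : fieldType) (p : nat) : comAlgType K :=
  GRing.ComAlgebra.clone K {poly %/ ('X^p : {poly K})} _.

Section JordanType.
Variables (K : fieldType) (p : nat).
Local Notation Kt := (truncPoly K p).

(* The action of q on [i.+1] = K[t]/t^(i.+1) in the basis 1, t, ..., t^i: the
   entry (r, c) is the coefficient of t^r in q * t^c. *)
Definition jordan_act (i : 'I_p) (q : Kt) : 'M[K]_i.+1 :=
  \matrix_(r, c) ((q : {poly K}) * 'X^c)`_r.

Lemma jordan_act_linear i : linear (jordan_act i).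
Proof.
move=> c q q'; apply/matrixP => r s; rewrite !mxE.
by rewrite mulrDl coefD -scalerAl coefZ.
Qed.

Lemma jordan_act_mult i : monoid_morphism (jordan_act i).
Proof.
split=> [|q q']; apply/matrixP => r s; rewrite !mxE.
  by rewrite mul1r coefXn.
have -> : ((q * q' : Kt) : {poly K}) = take_poly p ((q : {poly K}) * q').
  have e : mk_monic ('X^p : {poly K}) = 'X^p.
    by rewrite mk_monic_Xn prednK // (leq_ltn_trans _ (ltn_ord i)).
  rewrite [LHS]poly_of_qpolyM Pdiv.RingMonic.take_poly_rmodp.
  exact: congr1 e.
transitivity ((q : {poly K}) * ((q' : {poly K}) * 'X^s))`_r.
  rewrite mulrA !coefMXn; case: ifP => // _.
  rewrite coef_take_poly ifT //.
  by rewrite (leq_ltn_trans (leq_subr _ _)) // (leq_trans (ltn_ord r)) ?ltn_ord.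
rewrite coefMr (big_ord_widen i.+1 (fun j => (q : {poly K})`_(r - j) *
  ((q' : {poly K}) * 'X^s)`_j)) //.
rewrite big_mkcond; apply: eq_bigr => j _; rewrite !mxE ltnS.
by rewrite [in RHS]coefMXn; case: (leqP j r) => _; rewrite ?mul0r.
Qed.

HB.instance Definition _ (i : 'I_p) :=
  GRing.isLinear.Build K Kt 'M[K]_i.+1 _ (jordan_act i) (jordan_act_linear i).
HB.instance Definition _ (i : 'I_p) :=
  GRing.isMonoidMorphism.Build Kt 'M[K]_i.+1 (jordan_act i) (jordan_act_mult i).

Definition jordan_block (i : 'I_p) : fdModule Kt := FdModule (jordan_act i).

(* A Jordan type a_p[p] + ... + a_1[1] is the function a with a i = a_(i.+1). *)
Definition jordan_mod (a : {ffun 'I_p -> nat}) : fdModule Kt :=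
  \big[@dsum K Kt / zero_mod Kt]_(i < p)
    iter (a i) (dsum (jordan_block i)) (zero_mod Kt).

Definition has_jordan_type (M : fdModule Kt) (a : {ffun 'I_p -> nat}) : Prop :=
  mod_iso M (jordan_mod a).
End JordanType.

(* A closed subgroup scheme C of G: a surjective homomorphism of Hopf algebras
   k[G] -> k[C], e_a |-> \sum_c f a c e_c (compatibility with the antipodes is
   automatic for homomorphisms of bialgebras). *)
Record closed_subgroup (k : fieldType) (C G : finGroupScheme k)
    (f : 'M[k]_(gs_dim G, gs_dim C)) : Prop := ClosedSubgroup {
  cs_mul : forall a b c,
    \sum_r gs_mul a b r * f r c
      = \sum_a' \sum_b' f a a' * f b b' * gs_mul a' b' c;
  cs_unit : forall c, \sum_r gs_unit r * f r c = gs_unit c;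
  cs_comul : forall a c d,
    \sum_r f a r * gs_comul r c d
      = \sum_c' \sum_d' gs_comul a c' d' * f c' c * f d' d;
  cs_counit : forall a, \sum_r f a r * gs_counit r = gs_counit a;
  cs_surj : forall v : 'rV_(gs_dim C), exists u : 'rV_(gs_dim G), u *m f = v
}.

(* The inclusion kC -> kG dual to k[G] -> k[C]. *)
Definition subgroup_inc (k : fieldType) (C G : finGroupScheme k)
    (f : 'M[k]_(gs_dim G, gs_dim C)) (x : groupAlg C) : groupAlg G := x *m f^T.

Definition abelian_scheme (k : fieldType) (C : finGroupScheme k) : Prop :=
  forall a b c : 'I_(gs_dim C), gs_comul a b c = gs_comul a c b.

(* Every nonzero representation has a nonzero fixed vector. *)
Definition unipotent_scheme (k : fieldType) (C : finGroupScheme k) : Prop :=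
  forall V : fdModule (groupAlg C), (0 < mdim V)%N ->
  exists2 v : 'cV[k]_(mdim V), v != 0 & forall x, mact V x *m v = ga_aug x *: v.

Record piPoint (p : nat) (k : fieldType) (G : finGroupScheme k) := PiPoint {
  pi_field : fieldType;
  pi_emb : {rmorphism k -> pi_field};
  pi_map : {lrmorphism truncPoly pi_field p -> groupAlg (base_scheme pi_emb G)};
  pi_flat : left_flat pi_map;
  pi_factor : exists (C : finGroupScheme pi_field)
      (f : 'M_(gs_dim (base_scheme pi_emb G), gs_dim C))
      (beta : {lrmorphism truncPoly pi_field p -> groupAlg C}),
    [/\ closed_subgroup f, unipotent_scheme C, abelian_scheme C
      & forall q, pi_map q = subgroup_inc f (beta q)]
}.

Section ConstantJordanType.
Variables (p : nat) (k : fieldType) (G : finGroupScheme k).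

(* alpha_K^* (M_K) *)
Definition pi_res (P : piPoint p G) (M : fdModule (groupAlg G)) :
    fdModule (truncPoly (pi_field P) p) :=
  res_mod (pi_map P) (base_mod (pi_emb P) M).

(* alpha_K^* (zeta_K) *)
Definition pi_res_ext (P : piPoint p G) (N M : fdModule (groupAlg G))
    (zeta : Ext1 N M) : Ext1 (pi_res P N) (pi_res P M) :=
  Ext1_res (pi_map P) (Ext1_base (pi_emb P) zeta).

(* M has constant Jordan type a *)
Definition jordan_type_of (M : fdModule (groupAlg G)) (a : {ffun 'I_p -> nat}) :
    Prop :=
  forall P : piPoint p G, has_jordan_type (pi_res P M) a.

Definition constant_jordan_type (M : fdModule (groupAlg G)) : Prop :=
  exists a : {ffun 'I_p -> nat}, jordan_type_of M a.
End ConstantJordanType.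
Arguments jordan_type_of {p k G} M a.
Arguments constant_jordan_type p {k G} M.

(* Main.v *)
Require Import Defs.
From mathcomp Require Import all_boot all_order all_algebra.

Import GRing.Theory.
Local Open Scope ring_scope.

(** The class of an extension in Ext^1 is zero exactly when the extension is
    equivalent to the split one, so the middle term of an extension with zero
    class is isomorphic to the direct sum of its ends.  Restriction along a
    pi-point alpha_K sends the class of 0 -> M -> B -> N -> 0 to the class of
    the restricted sequence, hence alpha_K^*(B_K) is isomorphic to
    alpha_K^*(M_K) (+) alpha_K^*(N_K) ([ext_class_eq0_iso]).  Jordan types add
    up along direct sums ([has_jordan_type_dsum]), so the type of
    alpha_K^*(B_K) is the sum of the two constant types, whatever alpha_K is.

    The additivity of Jordan types is a rearrangement of the summands, derived
    from the interchange law (X (+) Y) (+) (Z (+) W) = (X (+) Z) (+) (Y (+) W)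
    and the unit laws of the zero module, all up to isomorphism. *)

Section DirectSumIso.
Context {F : fieldType} {A : algType F}.
Implicit Types X Y Z W : fdModule A.

Lemma mod_iso_refl X : mod_iso X X.
Proof. by exists (modHom1 X), (modHom1 X); rewrite /= mulmx1. Qed.

Lemma mod_iso_sym {X Y} : mod_iso X Y -> mod_iso Y X.
Proof. by case=> f [g [gf fg]]; exists g, f. Qed.

Lemma mod_iso_trans {X Y Z} : mod_iso X Y -> mod_iso Y Z -> mod_iso X Z.
Proof.
case=> f [g [gf fg]] [f' [g' [gf' fg']]].
exists (modHom_comp f' f), (modHom_comp g g'); split=> /=.
  by rewrite mulmxA -(mulmxA g) gf' mulmx1.
by rewrite mulmxA -(mulmxA f') fg mulmx1.
Qed.

Section DirectSumHom.
Context {X X' Y Y' : fdModule A} (f : modHom X X') (g : modHom Y Y').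

Definition dsum_hom_mx : 'M[F]_(mdim (dsum X' Y'), mdim (dsum X Y)) :=
  block_mx f 0 0 g.

Lemma dsum_homP a :
  mact (dsum X' Y') a *m dsum_hom_mx = dsum_hom_mx *m mact (dsum X Y) a.
Proof.
rewrite /= /dsum_act /dsum_hom_mx !mulmx_block.
by rewrite !(mulmx0, mul0mx, addr0, add0r) !hom_mxP.
Qed.
Definition dsum_hom : modHom (dsum X Y) (dsum X' Y') := ModHom dsum_homP.
End DirectSumHom.

Lemma mod_iso_dsum {X X' Y Y'} :
  mod_iso X X' -> mod_iso Y Y' -> mod_iso (dsum X Y) (dsum X' Y').
Proof.
case=> f [g [gf fg]] [f' [g' [gf' fg']]].
exists (dsum_hom f f'), (dsum_hom g g'); split;
  rewrite /= /dsum_hom_mx mulmx_block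
    !(mulmx0, mul0mx, addr0, add0r) ?gf ?fg ?gf' ?fg';
  by rewrite -scalar_mx_block.
Qed.

Section DirectSumSwap.
Variables X Y Z W : fdModule A.

Definition dsum_swap_mx :
    'M[F]_(mdim (dsum (dsum X Z) (dsum Y W)),
           mdim (dsum (dsum X Y) (dsum Z W))) :=
  block_mx (block_mx 1%:M 0 0 0) (block_mx 0 0 1%:M 0)
           (block_mx 0 1%:M 0 0) (block_mx 0 0 0 1%:M).

Lemma dsum_swapP a :
  mact (dsum (dsum X Z) (dsum Y W)) a *m dsum_swap_mx
    = dsum_swap_mx *m mact (dsum (dsum X Y) (dsum Z W)) a.
Proof.
rewrite /= /dsum_act /= /dsum_act /dsum_swap_mx !mulmx_block.
by rewrite !(mulmx0, mul0mx, addr0, add0r, mulmx1, mul1mx).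
Qed.
Definition dsum_swap :
  modHom (dsum (dsum X Y) (dsum Z W)) (dsum (dsum X Z) (dsum Y W)) :=
  ModHom dsum_swapP.
End DirectSumSwap.

Lemma dsum_swap_mxK X Y Z W :
  dsum_swap_mx X Z Y W *m dsum_swap_mx X Y Z W = 1%:M.
Proof.
rewrite /dsum_swap_mx !mulmx_block.
rewrite !(mulmx0, mul0mx, addr0, add0r, mulmx1, add_block_mx).
by rewrite !block_mx0 -!scalar_mx_block.
Qed.

Lemma dsumACA X Y Z W :
  mod_iso (dsum (dsum X Y) (dsum Z W)) (dsum (dsum X Z) (dsum Y W)).
Proof.
by exists (dsum_swap X Y Z W), (dsum_swap X Z Y W); split; apply: dsum_swap_mxK.
Qed.

Lemma dsum0m X : mod_iso (dsum (zero_mod A) X) X.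
Proof.
pose r : 'M[F]_(mdim (dsum (zero_mod A) X), mdim X) := col_mx 0 1%:M.
have rP a : mact (dsum (zero_mod A) X) a *m r = r *m mact X a.
  rewrite /= /dsum_act /r mul_block_col mul_col_mx.
  by rewrite !(mulmx0, mul0mx, add0r, mulmx1, mul1mx).
exists (dsum_outr X (zero_mod A)), (ModHom rP); split; last first.
  by rewrite /= /r /dsum_outr_mx mul_row_col mul0mx mulmx1 add0r.
rewrite /= /r /dsum_outr_mx mul_col_row !(mul0mx, mulmx0, mulmx1).
by rewrite [RHS]scalar_mx_block; congr block_mx; apply/matrixP => -[].
Qed.

Lemma dsumm0 X : mod_iso (dsum X (zero_mod A)) X.
Proof.
pose l : 'M[F]_(mdim X, mdim (dsum X (zero_mod A))) := row_mx 1%:M 0.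
have lP a : mact X a *m l = l *m mact (dsum X (zero_mod A)) a.
  rewrite /= /dsum_act /l mul_row_block mul_mx_row.
  by rewrite !(mulmx0, mul0mx, addr0, mulmx1, mul1mx).
exists (ModHom lP), (dsum_inl (zero_mod A) X); split; last first.
  by rewrite /= /l /dsum_inl_mx mul_row_col mul0mx mulmx1 addr0.
rewrite /= /l /dsum_inl_mx mul_col_row !(mul0mx, mulmx0, mulmx1).
by rewrite [RHS]scalar_mx_block; congr block_mx; apply/matrixP => -[].
Qed.

(** Interchange of the inner summands of (X (+) Y) (+) (0 (+) Z). *)
Lemma dsumA X Y Z : mod_iso (dsum (dsum X Y) Z) (dsum X (dsum Y Z)).
Proof.
apply: (@mod_iso_trans _ (dsum (dsum X Y) (dsum (zero_mod A) Z))).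
  exact: mod_iso_dsum (mod_iso_refl _) (mod_iso_sym (dsum0m Z)).
apply: mod_iso_trans (dsumACA _ _ _ _) _.
exact: mod_iso_dsum (dsumm0 X) (mod_iso_refl _).
Qed.

Lemma iter_dsumD X m n :
  mod_iso (dsum (iter m (dsum X) (zero_mod A)) (iter n (dsum X) (zero_mod A)))
          (iter (m + n) (dsum X) (zero_mod A)).
Proof.
elim: m => [|m IHm] /=; first exact: dsum0m.
apply: mod_iso_trans (dsumA _ _ _) _.
exact: mod_iso_dsum (mod_iso_refl X) IHm.
Qed.

(** The zero class is that of M -> M (+) N -> N, and an equivalence of
    extensions is in particular an isomorphism of their middle terms. *)
Lemma ext_class_eq0_iso {M N : fdModule A} (E : extension N M) :
  ext_class E = Ext1_zero N M -> mod_iso (ext_mod E) (dsum M N).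
Proof. by move/ext_classP => -[f [g [gf fg _ _]]]; exists f, g. Qed.
End DirectSumIso.

Section JordanTypeSum.
Context {K : fieldType} {p : nat}.
Implicit Types (M N : fdModule (truncPoly K p)) (a b : {ffun 'I_p -> nat}).

Lemma jordan_modD a b :
  mod_iso (dsum (jordan_mod K a) (jordan_mod K b))
          (jordan_mod K [ffun j => (a j + b j)%N]).
Proof.
rewrite /jordan_mod.
elim/big_rec3: _ => [|j x y z _ IH]; first exact: dsum0m.
rewrite ffunE.
apply: mod_iso_trans (dsumACA _ _ _ _) _.
exact: mod_iso_dsum (iter_dsumD _ _ _) IH.
Qed.

Lemma has_jordan_type_dsum M N a b :
  has_jordan_type M a -> has_jordan_type N b ->
  has_jordan_type (dsum M N) [ffun j => (a j + b j)%N].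
Proof.
by move=> Ma Nb; apply: mod_iso_trans (jordan_modD a b); apply: mod_iso_dsum.
Qed.
End JordanTypeSum.

Theorem proposition7p1 (k : fieldType) (p : nat) (p_char : p \in [pchar k])
    (G : finGroupScheme k) (M B N : fdModule (groupAlg G))
    (i : modHom M B) (q : modHom B N) (ex : short_exact i q)
    (M_const : constant_jordan_type p M) (N_const : constant_jordan_type p N)
    (zeta_res0 : forall alpha : piPoint p G,
       pi_res_ext alpha (ext_class (Extension ex))
         = Ext1_zero (pi_res alpha N) (pi_res alpha M)) :
  constant_jordan_type p B /\
  forall m n : {ffun 'I_p -> nat},
    jordan_type_of M m -> jordan_type_of N n ->
    jordan_type_of B [ffun j => (m j + n j)%N].
Proof.
have typeB (m n : {ffun 'I_p -> nat}) :
    jordan_type_of M m -> jordan_type_of N n ->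
    jordan_type_of B [ffun j => (m j + n j)%N].
  move=> Mm Nn alpha.
  have := zeta_res0 alpha.
  rewrite /pi_res_ext /Ext1_base /Ext1_res !Ext1_mapE => /ext_class_eq0_iso.
  move=> isoB; apply: mod_iso_trans isoB _.
  exact: has_jordan_type_dsum (Mm alpha) (Nn alpha).
split=> //; have [m Mm] := M_const; have [n Nn] := N_const.
by exists [ffun j => (m j + n j)%N]; apply: typeB.
Qed.
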